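(* Let $M^3$ be a Lagrangian submanifold of the homogeneous nearly Kähler sphere $\mathbb S^6(1)$, and let $S=(S_{ij})$ be the symmetric nonnegative definite matrix $S_{ij}=\sum_{a,b}h_{abi}h_{abj}$ built from the components $h_{ijk}$ of its second fundamental form at a point. Diagonalize $S$ at the point, say $S_{ij}=\mu_i\delta_{ij}$, and write $s=\sum_i\mu_i$, $q=\sum_i\mu_i^2$, $r=\sum_i\mu_i^3$. If $0\le\mu_i\le\tfrac{15}{8}$ for $i=1,2,3$ and $s^3+3sq-10r\ge0$, then $F(s,q,r)\ge0$, where $$F(s,q,r)=-\tfrac{11}{36}s^3+\tfrac{55}{36}sq-3r+\tfrac5{24}s^2+\tfrac{25}{24}q+\tfrac{25r}{16s}\quad\text{for } s>0,$$ and $F=0$ when $s=0$.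
   Context: $\mathbb S^6(1)$ is the unit sphere in the imaginary Cayley numbers $\mathbb R^7$ with its standard metric $\langle\cdot,\cdot\rangle$ and the almost complex structure $J_xX=x\times X$ given by the Cayley cross product. A three-dimensional submanifold $M^3$ is Lagrangian if $J(TM)=T^\perp M$; such a submanifold is automatically minimal. With $h$ the second fundamental form and $\{e_1,e_2,e_3\}$ a local oriented orthonormal tangent frame, $h_{ijk}=\langle h(e_i,e_j),Je_k\rangle$; these components are totally symmetric in $i,j,k$ and trace-free, i.e. $\sum_i h_{iik}=0$ for all $k$. The quantities $s,q,r$ equal $\operatorname{tr}S=|h|^2$, $\operatorname{tr}(S^2)$, $\operatorname{tr}(S^3)$, respectively. *)

(* Defs.v *)
From mathcomp Require Import all_boot all_order all_algebra.
From mathcomp Require Import all_classical all_reals all_analysis.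
From mathcomp Require Import ring.

Set Implicit Arguments.
Unset Strict Implicit.
Unset Printing Implicit Defensive.

Import Order.TTheory GRing.Theory Num.Theory.
Import numFieldNormedType.Exports.

Local Open Scope classical_set_scope.
Local Open Scope ring_scope.

(* The type 'rV[R]_7 stands for the imaginary Cayley numbers.  The library
   norm on it is the sup norm, so it is used only for the topology and for
   derivatives; the metric is [dot]. *)
Definition dot (R : realType) (n : nat) (u v : 'rV[R]_n) : R :=
  \sum_(i < n) u 0 i * v 0 i.

(* Imaginary part of the Cayley product, for the multiplication table
   e_i e_(i+1) = e_(i+3) with indices in Z/7 (and cyclic permutations of each
   such triple).  The coordinate k collects the three triples containing k. *)
Definition cross (R : realType) (u v : 'rV[R]_7) : 'rV[R]_7 :=
  \row_(k < 7)
    ((u 0 (k + 1%R) * v 0 (k + 3%:R) - u 0 (k + 3%:R) * v 0 (k + 1%R))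
   + (u 0 (k + 2%:R) * v 0 (k + 6%:R) - u 0 (k + 6%:R) * v 0 (k + 2%:R))
   + (u 0 (k + 4%:R) * v 0 (k + 5%:R) - u 0 (k + 5%:R) * v 0 (k + 4%:R))).

(* The next two lemmas are the defining properties of a cross product. *)
Lemma cross_orthogonal (R : realType) (u v : 'rV[R]_7) :
  dot (cross u v) u = 0 /\ dot (cross u v) v = 0.
Proof.
rewrite /dot !big_ord_recr !big_ord0 /= !mxE.
pose a (w : 'rV[R]_7) (n : nat) := w 0 (inord n).
have E (w : 'rV[R]_7) (i : 'I_7) : w 0 i = a w i by rewrite /a inord_val.
by split; rewrite !E /=; ring.
Qed.

Lemma cross_norm (R : realType) (u v : 'rV[R]_7) :
  dot (cross u v) (cross u v) = dot u u * dot v v - dot u v ^+ 2.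
Proof.
rewrite /dot !big_ord_recr !big_ord0 /= !mxE.
pose a (w : 'rV[R]_7) (n : nat) := w 0 (inord n).
have E (w : 'rV[R]_7) (i : 'I_7) : w 0 i = a w i by rewrite /a inord_val.
by rewrite !E /=; ring.
Qed.

Section Submanifolds.
Variable R : realType.

(* C^n on an open set U. *)
Fixpoint Cn_on (m k n : nat) (U : set 'rV[R]_m.+1)
    (g : 'rV[R]_m.+1 -> 'rV[R]_k.+1) : Prop :=
  match n with
  | 0%N => forall x, U x -> {for x, continuous g}
  | n'.+1 => (forall x, U x -> differentiable g x) /\
             (forall v, Cn_on n' U (fun x => 'D_v g x))
  end.

Definition smooth_on (m k : nat) (U : set 'rV[R]_m.+1)
    (g : 'rV[R]_m.+1 -> 'rV[R]_k.+1) : Prop := forall n, Cn_on n U g.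

Section Immersed.
Variables (M : topologicalType) (f : M -> 'rV[R]_7).

(* phi restricts to a homeomorphism from the open set U of R^3 onto an open
   subset of M, and f \o phi is a smooth immersion on U. *)
Definition local_param (U : set 'rV[R]_3) (phi : 'rV[R]_3 -> M) : Prop :=
  [/\ open U,
      {in U &, injective phi},
      (forall x, U x -> {for x, continuous phi}),
      (forall V, V `<=` U -> open V -> open (phi @` V)) &
      smooth_on U (f \o phi) /\
      (forall x, U x -> forall v, 'D_v (f \o phi) x = 0 -> v = 0)].

(* M is a 3-manifold immersed by f in the unit sphere of R^7.  Its smooth
   structure is the one given by all local parametrizations: since each
   f \o phi is an immersion, transition maps are automatically smooth. *)
Definition immersed3_in_S6 : Prop :=
  [/\ hausdorff_space M,
      @second_countable M,
      (forall p, dot (f p) (f p) = 1) &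
      (forall p, exists U phi, local_param U phi /\ (phi @` U) p)].

Definition tangent_space (p : M) : set 'rV[R]_7 :=
  [set X | exists U phi x v,
    [/\ local_param U phi, U x, phi x = p & X = 'D_v (f \o phi) x]].

(* Normal space of M inside the sphere. *)
Definition normal_space (p : M) : set 'rV[R]_7 :=
  [set N | dot N (f p) = 0 /\ forall X, tangent_space p X -> dot N X = 0].

(* J(TM) = T^\perp M, with J_x X = x \times X. *)
Definition lagrangian : Prop :=
  immersed3_in_S6 /\
  forall p, cross (f p) @` tangent_space p = normal_space p.

(* h(X, Y) is the component in [normal_space p] of the covariant derivative of
   a tangent field extending Y along X; the field 'D_b (f \o phi) with b
   constant is used as the extension.  The covariant derivative of the sphere
   differs from that of R^7 by a multiple of f p, which is orthogonal to
   [normal_space p].  The set below is a singleton for X, Y tangent at p. *)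
Definition second_fundamental_form (p : M) (X Y : 'rV[R]_7) : 'rV[R]_7 :=
  xget 0 [set H | normal_space p H /\
    exists U phi x a b,
      [/\ local_param U phi, U x, phi x = p,
          X = 'D_a (f \o phi) x /\ Y = 'D_b (f \o phi) x &
          forall N, normal_space p N ->
            dot ('D_a (fun y => 'D_b (f \o phi) y) x - H) N = 0]].

Definition orthonormal_tangent_frame (p : M) (e : 'I_3 -> 'rV[R]_7) : Prop :=
  (forall i, tangent_space p (e i)) /\
  (forall i j, dot (e i) (e j) = (i == j)%:R).

Definition h_comp (p : M) (e : 'I_3 -> 'rV[R]_7) (i j k : 'I_3) : R :=
  dot (second_fundamental_form p (e i) (e j)) (cross (f p) (e k)).

Definition S_mx (p : M) (e : 'I_3 -> 'rV[R]_7) : 'M[R]_3 :=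
  \matrix_(i, j) \sum_a \sum_b h_comp p e a b i * h_comp p e a b j.

End Immersed.
End Submanifolds.

Definition F (R : realType) (s q r : R) : R :=
  if s == 0 then 0 else
  - (11%:R / 36%:R) * s ^+ 3 + 55%:R / 36%:R * s * q - 3%:R * r
  + 5%:R / 24%:R * s ^+ 2 + 25%:R / 24%:R * q + 25%:R * r / (16%:R * s).

(* Main.v *)
(* The product s F is a quartic form plus 15/8 times a nonnegative cubic form,
   so 15/8 may be lowered to the largest eigenvalue, which is then scaled to 1.
   In terms of the sum t and the product w of the two other eigenvalues, both
   s F and s^3 + 3sq - 10r are affine in w, so it suffices to look at the ends
   of the range of w: t^2/4 above; below, t - 1 if t >= 1, and otherwise the
   zero of s^3 + 3sq - 10r.  There s F is a polynomial in t, with the factors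
   2 - t or 3t - 2 coming from the equality cases (1, 1, 1) and
   (1, 1/3, 1/3). *)
Require Import Defs.
From mathcomp Require Import all_boot all_order all_algebra.
From mathcomp Require Import all_classical all_reals all_analysis.
From mathcomp Require Import ring lra.

Import Order.TTheory GRing.Theory Num.Theory.

Local Open Scope ring_scope.

(* The quartic is 36 s F, and the last hypothesis (s^3 + 3sq - 10r) / 6, for the
   eigenvalues 1, u, v with u + v = t and u v = w. *)
Lemma sum_prod_quartic_ge0 (K : realFieldType) (t w : K) :
  0 <= t <= 2 -> 0 <= w -> t - 1 <= w -> 4 * w <= t ^+ 2 ->
  0 <= (4 * t - 1) * w - (1 + t) * (1 - t) ^+ 2 ->
  0 <= - 64 * t ^+ 4 + 12 * t ^+ 3 + 76 * t ^+ 2 - 10 * t - 10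
       + 2 * (107 * t ^+ 2 - 13 * t - 75) * w.
Proof.
move=> /andP[t0 t2] w0 tw wt D0.
have t14 : 1 < 4 * t.
  rewrite ltNge; apply/negP => t14.
  have : 0 <= (1 - 4 * t) * w by apply: mulr_ge0 => //; lra.
  have : 0 < (1 + t) * (1 - t) ^+ 2.
    by apply: mulr_gt0; [lra | apply: exprn_gt0; lra].
  lra.
have t23 : 0 <= 3 * t - 2.
  have : 0 <= (3 * t - 2) * (t + 2).
    have : 0 <= (4 * t - 1) * (t ^+ 2 - 4 * w) by apply: mulr_ge0; lra.
    lra.
  by rewrite pmulr_lge0 //; lra.
have [c0|c0] := leP (107 * t ^+ 2 - 13 * t - 75) 0.
  have : 0 <= (75 + 13 * t - 107 * t ^+ 2) * (t ^+ 2 - 4 * w).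
    by apply: mulr_ge0; lra.
  have : 0 <= (2 - t) * (3 * t - 2) * (7 * t ^+ 2 + 15 * t + 5).
    have := sqr_ge0 t.
    by move=> tt; apply: mulr_ge0; [apply: mulr_ge0|]; lra.
  lra.
have [t1|t1] := leP 1 t.
  have : 0 <= (107 * t ^+ 2 - 13 * t - 75) * (w - (t - 1)).
    by apply: mulr_ge0; lra.
  have : 0 <= (2 - t) * (32 * t ^+ 3 - 49 * t ^+ 2 - 16 * t + 35).
    apply: mulr_ge0; first lra.
    (* 7/6 is close to the minimum point of the cubic, where it is about 0.45. *)
    have : 0 <= (t - 7 / 6) ^+ 2 * (32 * t + 77 / 3).
      by apply: mulr_ge0; [exact: sqr_ge0 | lra].
    lra.
  lra.
have : 0 <= (107 * t ^+ 2 - 13 * t - 75) *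
            ((4 * t - 1) * w - (1 + t) * (1 - t) ^+ 2).
  by apply: mulr_ge0 => //; lra.
have : 0 <= (3 * t - 2) *
            (35 + 29 * t - 25 * t ^+ 2 - 26 * t ^+ 3 - 7 * t ^+ 4).
  apply: mulr_ge0 => //.
  have : t ^+ 2 <= 1 by rewrite expr_le1 //; lra.
  have : t ^+ 3 <= t by rewrite exprS ler_piMr // expr_le1 //; lra.
  have : t ^+ 4 <= t by rewrite exprS ler_piMr // expr_le1 //; lra.
  lra.
move=> lo step; rewrite -(pmulr_rge0 _ (_ : 0 < 4 * t - 1)); lra.
Qed.

Lemma eigenvalue_quartic_ge0 (K : realFieldType) (c x y z : K) :
  let s := x + y + z in
  let q := x ^+ 2 + y ^+ 2 + z ^+ 2 in
  let r := x ^+ 3 + y ^+ 3 + z ^+ 3 in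
  0 < x <= c -> 0 <= y <= x -> 0 <= z <= x ->
  0 <= s ^+ 3 + 3 * s * q - 10 * r ->
  0 <= - 11 * s ^+ 4 + 55 * s ^+ 2 * q - 108 * r * s
       + c * (4 * s ^+ 3 + 20 * s * q + 30 * r).
Proof.
move=> s q r /andP[x0 xc] /andP[y0 yx] /andP[z0 zx] D0.
have s0 : 0 <= s by rewrite !addr_ge0 // ltW.
have q0 : 0 <= q by rewrite !addr_ge0 ?sqr_ge0.
have r0 : 0 <= r by rewrite !addr_ge0 ?exprn_ge0 // ltW.
have lower_c : 0 <= (c - x) * (4 * s ^+ 3 + 20 * s * q + 30 * r).
  rewrite mulr_ge0 ?subr_ge0 //.
  have := exprn_ge0 3 s0; have := mulr_ge0 s0 q0; lra.
suff : 0 <= - 11 * s ^+ 4 + 55 * s ^+ 2 * q - 108 * r * s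
            + x * (4 * s ^+ 3 + 20 * s * q + 30 * r) by lra.
have xV0 : x != 0 by rewrite gt_eqF.
pose u := y / x; pose v := z / x.
have u0 : 0 <= u by rewrite divr_ge0 // ltW.
have v0 : 0 <= v by rewrite divr_ge0 // ltW.
have u1 : u <= 1 by rewrite ler_pdivrMr // mul1r.
have v1 : v <= 1 by rewrite ler_pdivrMr // mul1r.
have yE : y = u * x by rewrite divfK.
have zE : z = v * x by rewrite divfK.
have uv0 : 0 <= u * v by rewrite mulr_ge0.
have uv1 : u + v - 1 <= u * v.
  have : 0 <= (1 - u) * (1 - v) by rewrite mulr_ge0 ?subr_ge0.
  lra.
have uv4 : 4 * (u * v) <= (u + v) ^+ 2 by have := sqr_ge0 (u - v); lra.
have D1 : 0 <= (4 * (u + v) - 1) * (u * v)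
               - (1 + (u + v)) * (1 - (u + v)) ^+ 2.
  have x3 : 0 < 6 * x ^+ 3 by rewrite mulr_gt0 ?exprn_gt0 // ltr0n.
  rewrite -(pmulr_rge0 _ x3); move: D0; rewrite /s /q /r yE zE.
  by congr (0 <= _); ring.
have t02 : 0 <= u + v <= 2 by apply/andP; split; lra.
have := sum_prod_quartic_ge0 _ _ _ t02 uv0 uv1 uv4 D1.
rewrite -(pmulr_rge0 _ (exprn_gt0 4 x0)) /s /q /r yE zE.
by congr (0 <= _); ring.
Qed.

Lemma F_ge0_of_max (R : realType) (x y z : R) :
  let s := x + y + z in
  let q := x ^+ 2 + y ^+ 2 + z ^+ 2 in
  let r := x ^+ 3 + y ^+ 3 + z ^+ 3 in
  x <= 15 / 8 -> 0 <= y <= x -> 0 <= z <= x ->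
  0 <= s ^+ 3 + 3 * s * q - 10 * r -> 0 <= F s q r.
Proof.
move=> s q r xc yx zx D0; rewrite /F; case: eqP => [//|/eqP s_neq0].
have x0 : 0 < x.
  rewrite ltNge; apply/negP => x0; case/negP: s_neq0; apply/eqP.
  by rewrite /s; lra.
have s0 : 0 < s by rewrite /s; lra.
have x0c : 0 < x <= 15 / 8 by rewrite x0.
have quartic := eigenvalue_quartic_ge0 _ _ _ _ _ x0c yx zx D0.
have s36 : 0 < 36 * s by rewrite mulr_gt0 // ltr0n.
rewrite -(pmulr_rge0 _ s36); move: quartic; rewrite -/s -/q -/r.
by congr (0 <= _); field.
Qed.

Theorem lemma4p2 (R : realType) (M : topologicalType) (f : M -> 'rV[R]_7)
    (M_lagrangian : lagrangian f)
    (p : M) (e : 'I_3 -> 'rV[R]_7)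
    (e_frame : orthonormal_tangent_frame f p e)
    (mu : 'I_3 -> R)
    (S_diag : forall i j, S_mx f p e i j = mu i * (i == j)%:R) :
  let s := \sum_i mu i in
  let q := \sum_i mu i ^+ 2 in
  let r := \sum_i mu i ^+ 3 in
  (forall i, 0 <= mu i <= 15%:R / 8%:R) ->
  0 <= s ^+ 3 + 3%:R * s * q - 10%:R * r ->
  0 <= F s q r.
Proof.
move=> s q r mu_bnd D0.
have [k k_max] : exists k, forall i, mu i <= mu k.
  case: (arg_maxP mu (erefl (predT ord0))) => k _ kP.
  by exists k => i; exact: kP.
have [i [j sumE]] : exists i j,
    forall g : 'I_3 -> R, \sum_l g l = g k + g i + g j.
  have sum3 (g : 'I_3 -> R) : \sum_l g l = g 0 + g 1 + g 2.
    rewrite !big_ord_recl big_ord0 addr0 addrA.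
    by congr (_ + g _ + g _); exact: val_inj.
  case: (k) => -[|[|[|//]]] kP.
  - have -> : Ordinal kP = 0 by exact: val_inj.
    by exists 1, 2.
  - have -> : Ordinal kP = 1 by exact: val_inj.
    by exists 0, 2 => g; rewrite sum3 (addrC (g 1)).
  - have -> : Ordinal kP = 2 by exact: val_inj.
    by exists 0, 1 => g; rewrite sum3 addrC addrA.
have le_k l : 0 <= mu l <= mu k by rewrite k_max andbT; case/andP: (mu_bnd l).
have /andP[_ mukc] := mu_bnd k.
move: D0; rewrite /s /q /r !sumE.
exact: F_ge0_of_max.
Qed.
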